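(* Let $X$ be a hereditarily meta-Lindelöf Hausdorff space containing a dense Baire metrizable subset, that is, a dense subset $M \subset X$ which with the subspace topology is both metrizable and a Baire space. Then $dis(X) \geq \Delta(X)$.
   Context: All spaces are Hausdorff. A space is called meta-Lindelöf if every open cover has a point-countable open refinement (a cover by open sets, each contained in a member of the original cover, such that every point lies in at most countably many of them); it is hereditarily meta-Lindelöf if every subspace is meta-Lindelöf. $dis(X)$ denotes the least number of discrete sets required to cover $X$ (a subset of $X$ is discrete if its subspace topology is discrete; it need not be closed in $X$). $\Delta(X)$ denotes the least cardinality of a nonempty open subset of $X$ (for nonempty $X$). *)

(* Defs.v *)
From HB Require Import structures.
From mathcomp Require Import all_boot all_order all_algebra.
From mathcomp Require Import all_classical all_reals topology.

Set Implicit Arguments.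
Unset Strict Implicit.
Unset Printing Implicit Defensive.

Local Open Scope classical_set_scope.
Local Open Scope card_scope.

(* The cardinals of any nonempty family of subsets of T have a minimum: a
   maximal set S of choice functions of the family, all of whose evaluation maps
   are injective on S, must evaluate onto some member, which then embeds in all
   the others. *)
Lemma card_le_minimum (T : Type) (P : set (set T)) :
  P !=set0 -> exists A, P A /\ forall B, P B -> A #<= B.
Proof.
move=> [A0 PA0].
elim/Pchoice: T => T in P A0 PA0 *.
pose I := set_type P.
pose Q (S : set (I -> T)) := (forall f, S f -> forall i : I, (val i : set T) (f i)) /\
  (forall (i : I) f g, S f -> S g -> f i = g i -> f = g).
have [F FQ Ftot|S [[S1 S2] Smax]] := @Zorn_bigcup (I -> T) Q.
  split=> [f [G FG Gf]|i f g [G FG Gf] [H FH Hg]]; first exact: (FQ _ FG).1.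
  have [GH|HG] := Ftot _ _ FG FH.
    by apply: (FQ _ FH).2 => //; exact: GH.
  by apply: (FQ _ FG).2 => //; exact: HG.
have [i iS] : exists i : I, forall a, (val i : set T) a -> exists f, S f /\ f i = a.
  apply: contrapT => /forallNP noi.
  have /choice[g gP] : forall i : I, exists a,
      (val i : set T) a /\ forall f, S f -> f i <> a.
    move=> i; have /existsNP[a /not_implyP[ia /forallNP nf]] := noi i.
    by exists a; split=> // f Sf fa; apply: (nf f).
  apply: (Smax (S `|` [set g])).
    split; first by move=> f; left.
    move=> SE; have Sg : S g by apply: SE; right.
    by have [_ /(_ _ Sg)] := gP (exist _ A0 (mem_set PA0)); apply.
  split=> [f [Sf|->] i|i f h]; [exact: S1|exact: (gP i).1|].
  move=> [Sf|->] [Sh|->] //.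
  - exact: S2.
  - by move=> fg; have := (gP i).2 _ Sf fg.
  - by move=> /esym hg; have := (gP i).2 _ Sh hg.
exists (val i); split; first exact: set_mem (valP i).
move=> B PB; pose j : I := exist _ B (mem_set PB).
have /choice[F FP] : forall a, exists f : I -> T,
    (val i : set T) a -> S f /\ f i = a.
  move=> a; have [ia|nia] := pselect ((val i : set T) a).
    by have [f ?] := iS _ ia; exists f.
  by exists (fun=> a).
pose h a := F a j.
have hI : {in val i &, injective h}.
  move=> a b /set_mem ia /set_mem ib hab.
  have [Sa <-] := FP _ ia; have [Sb <-] := FP _ ib.
  by rewrite (S2 j _ _ Sa Sb hab).
rewrite -(card_le_eql (inj_card_eq hI)); apply: subset_card_le.
by move=> _ [a ia <-]; have [Sa _] := FP _ ia; exact: (S1 _ Sa j).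
Qed.

(* A cardinal is represented by a set of that cardinality: least_card P is a
   member of P of least cardinality. *)
Definition least_card (T : Type) (P : set (set T)) : set T :=
  xget set0 [set A | P A /\ forall B, P B -> A #<= B].

Lemma least_cardP (T : Type) (P : set (set T)) : P !=set0 ->
  P (least_card P) /\ forall B, P B -> least_card P #<= B.
Proof.
move=> /card_le_minimum[A PA].
exact: (@xgetPex _ set0 [set A | P A /\ forall B, P B -> A #<= B] (ex_intro _ A PA)).
Qed.

(* Subspaces are the types [set_type A] with their initial topology, not
   [subspace A], which retains the points outside A as isolated points. *)

Definition discrete_subset (X : topologicalType) (A : set X) : Prop :=
  forall U : set (set_type A), open U.

Definition dis (X : topologicalType) : set (set X) :=
  least_card [set D : set (set X) |
    (forall A, D A -> discrete_subset A) /\ \bigcup_(A in D) A = setT].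

Arguments dis : clear implicits.

Definition Delta (X : topologicalType) : set X :=
  least_card [set U : set X | open U /\ U !=set0].

Arguments Delta : clear implicits.

Definition open_cover (X : topologicalType) (C : set (set X)) : Prop :=
  (forall U, C U -> open U) /\ \bigcup_(U in C) U = setT.

Definition refines (T : Type) (D C : set (set T)) : Prop :=
  forall V, D V -> exists2 U, C U & V `<=` U.

Definition point_countable (T : Type) (C : set (set T)) : Prop :=
  forall x, countable [set U | C U /\ U x].

Definition meta_lindelof (X : topologicalType) : Prop :=
  forall C : set (set X), open_cover C ->
    exists D, [/\ open_cover D, refines D C & point_countable D].

Definition hereditarily_meta_lindelof (X : topologicalType) : Prop :=
  forall A : set X, meta_lindelof (set_type A).

(* m is a metric structure on the points of X, with its own topology. *)
Definition metrizable (R : realType) (X : topologicalType) : Prop :=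
  exists m : Metric.axioms_ R X,
    forall x : X, @nbhs X (Metric.Pack m) x = @nbhs X X x.

Lemma metrizableP (R : realType) (X : topologicalType) : metrizable R X <->
  exists d : X -> X -> R, [/\ forall x, d x x = 0%R, forall x y, d x y = 0%R -> x = y,
   forall x y, d x y = d y x, forall y x z, (d x z <= d x y + d y z)%R &
   forall x A, nbhs x A <-> exists2 e : R, (0 < e)%R & [set y | (d x y < e)%R] `<=` A].
Proof.
split=> [[m mE]|[d [d0 dp ds dt dn]]].
  pose M : metricType R := Metric.Pack m.
  exists (@mdist R M); split.
  - exact: (@mdistxx R M).
  - exact: (@mdist_positivity R M).
  - exact: (@metric_sym R M).
  - by move=> y x z; exact: (@metric_triangle R M).
  - move=> x A; rewrite -mE -(@nbhs_ballE R M) /nbhs_ball_; split.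
      by move=> [e e0 /=]; rewrite (@ballEmdist R M) => eA; exists e.
    by move=> [e e0 eA]; exists e => //=; rewrite (@ballEmdist R M).
pose M : metricType R := HB.pack (Choice.sort X) (@isMetric.Build R X d d0 dp ds dt).
exists (Metric.class M) => x; apply/funext => A; apply/propext.
rewrite dn.
change (@nbhs M M x A <-> exists2 e : R, (0 < e)%R & [set y | (d x y < e)%R] `<=` A).
rewrite -(@nbhs_ballE R M); split=> -[e e0 eA]; exists e => //.
Qed.

Definition baire_space (X : topologicalType) : Prop :=
  forall F : nat -> set X,
    (forall i, open (F i) /\ dense (F i)) -> dense (\bigcap_i F i).

(* The extremal families defining dis and Delta are never empty. *)

Lemma disP (X : topologicalType) :
  [/\ forall A : set X, dis X A -> discrete_subset A, \bigcup_(A in dis X) A = setT &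
      forall D : set (set X), (forall A : set X, D A -> discrete_subset A) ->
        \bigcup_(A in D) A = setT -> dis X #<= D].
Proof.
have [|[d1 d2] d3] := @least_cardP _ [set D : set (set X) |
    (forall A, D A -> discrete_subset A) /\ \bigcup_(A in D) A = setT].
  exists (range set1); split=> [_ [x _ <-] U|].
    rewrite openE => -[y yx] Uy; rewrite /interior.
    apply: filterS (@filterT _ (nbhs _) _) => -[z zx] _.
    have zy : z = y by rewrite (set_mem zx) (set_mem yx).
    by subst z; rewrite (Prop_irrelevance zx yx).
  by apply/seteqP; split=> // x _; exists [set x].
by split=> // D D1 D2; apply: d3.
Qed.

Lemma DeltaP (X : topologicalType) : [set: X] !=set0 ->
  [/\ open (Delta X), Delta X !=set0 &
      forall U : set X, open U -> U !=set0 -> Delta X #<= U].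
Proof.
move=> X0; have [|[d1 d2] d3] := @least_cardP _ [set U : set X | open U /\ U !=set0].
  by exists setT; split=> //; exact: openT.
by split=> // U U1 U2; apply: d3.
Qed.

(* Main.v *)
Require Import Defs.
From HB Require Import structures.
From mathcomp Require Import all_boot all_order all_algebra.
From mathcomp Require Import all_classical all_reals topology.

Import Order.TTheory GRing.Theory Num.Theory.

(** Let K be a family of discrete sets covering X, of least cardinality. The
    proof produces a nonempty open set V of cardinality at most that of K.

    First, V is chosen so as to have a dense subset no larger than K. On the
    metrizable dense set M, with metric d, the trace of each member A of K is
    discrete, hence the union over n of its parts A_n, where A_n consists of
    the points of A at distance at least 1/(n+1) from the rest of A. Let F_n
    be the union of the A_n over all A in K. The F_n cover M, so by the Baire
    property some F_n is dense in a nonempty open subset of M, which can be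
    shrunk to an open U any two points of which are closer than 1/(n+1). Then U
    meets each A_n in at most one point, so its dense subset made of the points of F_n in U
    injects into K ([baire_metrizable_small_density]). Since M is dense in X,
    this set is also dense in an open V of X with trace U on M
    ([dense_subspace_small_density]).

    Next, a discrete set A contained in V is no larger than K when K is
    infinite. Separate the points of A by open sets, and refine these to a
    point-countable open family: distinct points of A lie in distinct members,
    each member meets the small dense set, and each point of the dense set
    lies in countably many members ([meta_lindelof_discrete_card]). So V is
    the union of K many sets no larger than K, and |K| * |K| = |K|
    ([infinite_setX_le]) bounds V by K.

    When K is finite, so is the dense subset of V; being closed, it contains
    V. A finite nonempty open set in a Hausdorff space has isolated points, so
    Delta X has at most one point ([finite_open_Delta_le1]). *)

Local Open Scope classical_set_scope.
Local Open Scope card_scope.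

(** * Cardinal arithmetic *)

(** Most injections below pick, for each point, one of several possible codes;
    a relation from which no two points can receive the same code avoids
    committing to the choice. *)
Lemma card_le_rel {T U : Type} {A : set T} {B : set U} (r : T -> U -> Prop) :
  (forall a, A a -> exists b, B b /\ r a b) ->
  (forall a a' b, A a -> A a' -> r a b -> r a' b -> a = a') -> A #<= B.
Proof.
move=> rT rI.
have /choice[f fP] : forall a : set_type A, exists b : set_type B, r (val a) (val b).
  move=> a; have [b [Bb rab]] := rT _ (set_mem (valP a)).
  by exists (exist _ b (mem_set Bb)).
have fI : {in [set: A] &, injective f}.
  move=> a a' _ _ faa'; apply/val_inj/(rI _ _ (val (f a))) => //.
  - exact: set_mem (valP a).
  - exact: set_mem (valP a').
  - by rewrite faa'.
rewrite -(card_le_eql (card_setT A)) -(card_le_eql (inj_card_eq fI)).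
by rewrite -(card_le_eqr (card_setT B)); exact: subset_card_le.
Qed.

Lemma card_le_fun {T U : Type} {A : set T} {B : set U} :
  B !=set0 -> A #<= B ->
  exists f : T -> U, (forall a, B (f a)) /\ {in A &, injective f}.
Proof.
move=> [b0 Bb0] /card_leP[f].
exists (fun a => if pselect (A a) is left Aa then val (f (SigSub (mem_set Aa))) else b0).
split=> [a|a a' /set_mem Aa /set_mem Aa'].
  by case: pselect => // Aa; exact: set_mem (valP _).
case: pselect => // {}Aa; case: pselect => // {}Aa' /val_inj/('inj_f) E.
by have /(congr1 val) := E (mem_set I) (mem_set I).
Qed.

Lemma card_le_setX {T U T' U' : Type} {A : set T} {B : set U} {A' : set T'}
    {B' : set U'} : A #<= A' -> B #<= B' -> A `*` B #<= A' `*` B'.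
Proof.
have [->|/set0P A'0] := eqVneq A' set0.
  by rewrite card_le0 => /eqP-> _; rewrite set0X.
have [->|/set0P B'0] := eqVneq B' set0.
  by rewrite (card_le0 _ B) => _ /eqP->; rewrite setX0.
move=> /(card_le_fun A'0)[f [fA fI]] /(card_le_fun B'0)[g [gB gI]].
apply: (card_le_rel (fun x y => (f x.1, g x.2) = y)).
  by move=> x _; exists (f x.1, g x.2); split=> //; split; [exact: fA|exact: gB].
move=> [a b] [a' b'] y [/= Aa Bb] [/= Aa' Bb'] <- [fE gE].
congr pair; [apply: fI|apply: gI] => //; exact/mem_set.
Qed.

(** Any two subsets of a type are comparable, as the two of them have a member
    of least cardinality. *)
Lemma card_le_total {T : Type} (A B : set T) : A #<= B \/ B #<= A.
Proof.
have [|C [CAB Cmin]] := @card_le_minimum T [set C | C = A \/ C = B].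
  by exists A; left.
by case: CAB => <-; [left|right]; apply: Cmin; [right|left].
Qed.

(** Code a point by an index i of a set that contains it, together with its
    image under an injection of the i-th set: this lands in the square of K. *)
Lemma bigcup_card_le {I T U : Type} (K : set U) (D : set I) (F : I -> set T) :
  K `*` K #<= K -> D #<= K -> (forall i, D i -> F i #<= K) ->
  \bigcup_(i in D) F i #<= K.
Proof.
move=> KK DK FK; apply: card_le_trans KK.
have [K0|/set0P K0] := eqVneq K set0.
  rewrite K0 in DK FK *; have -> : D = set0 by apply/eqP; rewrite -(card_le0 U).
  by rewrite bigcup_set0.
have [f [fK fI]] := card_le_fun K0 DK.
have /choice[g gP] : forall i, exists g : T -> U,
    D i -> (forall a, K (g a)) /\ {in F i &, injective g}.
  move=> i; have [Di|nDi] := pselect (D i); last by case: K0 => k _; exists (fun=> k).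
  by have [g gP] := card_le_fun K0 (FK i Di); exists g.
apply: (card_le_rel (fun x k => exists i, [/\ D i, F i x & k = (f i, g i x)])).
  move=> x [i Di Fix]; exists (f i, g i x); split; last by exists i.
  by split=> /=; [exact: fK|exact: (gP i Di).1].
move=> x y _ _ _ [i [Di Fix ->]] [j [Dj Fjy [fE gE]]].
have ij : i = j by apply: fI => //; rewrite inE.
by subst j; apply: (gP i Di).2; rewrite ?inE.
Qed.

Lemma setU_card_le {T U : Type} (K : set U) (A B : set T) :
  infinite_set K -> K `*` K #<= K -> A #<= K -> B #<= K -> A `|` B #<= K.
Proof.
move=> Kinf KK AK BK.
have -> : A `|` B = \bigcup_(b in [set: bool]) (if b then A else B).
  apply/seteqP; split=> [x [Ax|Bx]|x [[] _ ?]].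
  - by exists true.
  - by exists false.
  - by left.
  - by right.
apply: bigcup_card_le => //; last by case.
by apply: card_le_trans (countableP _) _; apply/infiniteP.
Qed.

(** Hessenberg's theorem. By Zorn's lemma there is a maximal B inside A carrying
    an injection of B x B into B. If C is disjoint from B and the square of
    their union injects into C, the injection extends to that union; so
    maximality forbids such a C. If B were finite, a countable C would do; if A
    minus B had cardinality at least that of B, a copy C of B would do. Hence B
    is infinite and A minus B is no larger than B, so A is no larger than B. *)
Lemma infinite_setX_le {T : Type} (A : set T) :
  infinite_set A -> A `*` A #<= A.
Proof.
move=> Ainf.
(* An injection is represented by its graph G, a set of triples, so that
   extension is inclusion; its domain is read off the diagonal. *)
pose dom (G : set (T * T * T)) := [set x | exists z, G (x, x, z)].
pose Q (G : set (T * T * T)) := [/\ dom G `<=` A,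
  (forall x y, dom G x -> dom G y -> exists z, G (x, y, z)),
  (forall x y z, G (x, y, z) -> dom G z) &
  (forall p q z, G (p, z) -> G (q, z) -> p = q)].
have [F FQ Ftot|G [[GA GT Gdom GI] Gmax]] := @Zorn_bigcup _ Q.
  have domF G x : F G -> dom G x -> dom (\bigcup_(X in F) X) x.
    by move=> FG [z Gz]; exists z, G.
  split.
  - by move=> x [z [G FG Gz]]; have [GA _ _ _] := FQ _ FG; apply: GA; exists z.
  - move=> x y [z [G FG Gz]] [w [H FH Hw]].
    have [GH|HG] := Ftot _ _ FG FH.
      have [_ HT _ _] := FQ _ FH.
      by have [||v Hv] := HT x y; [exists z; exact: GH|exists w|exists v, H].
    have [_ GT _ _] := FQ _ FG.
    by have [||v Gv] := GT x y; [exists z|exists w; exact: HG|exists v, G].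
  - by move=> x y z [G FG Gz]; have [_ _ Gd _] := FQ _ FG; apply: domF FG (Gd _ _ _ Gz).
  - move=> p q z [G FG Gz] [H FH Hz]; have [GH|HG] := Ftot _ _ FG FH.
      by have [_ _ _ HI] := FQ _ FH; apply: HI Hz => //; exact: GH.
    by have [_ _ _ GI] := FQ _ FG; apply: GI Gz _; exact: HG.
set B := dom G in GA GT Gdom.
have BB : B `*` B #<= B.
  apply: (card_le_rel (fun p z => G (p, z))).
    by move=> [x y] [/= /GT xT /xT[z Gz]]; exists z; split=> //; exact: Gdom Gz.
  by move=> p q z _ _; exact: GI.
have noext C : C `<=` A `\` B -> C !=set0 -> ~ ((B `|` C) `*` (B `|` C) #<= C).
  move=> CAB [c Cc] /(card_le_fun (ex_intro _ c Cc))[h [hC hI]].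
  (* The new pairs are sent into C, hence never onto an old value. *)
  pose N := [set u : T * T * T |
    [/\ ((B `|` C) `*` (B `|` C)) u.1, ~ (B `*` B) u.1 & u.2 = h u.1]].
  have domE : dom (G `|` N) = B `|` C.
    apply/seteqP; split=> x.
      by move=> [z [Gz|[[/= xBC _] _ _]]] //; left; exists z.
    have [[z Gz] _|nBx [//|Cx]] := pselect (B x); first by exists z; left.
    by exists (h (x, x)); right; split=> //=; [split; right|case].
  apply: (Gmax (G `|` N)).
    split=> [|GN]; first by move=> u; left.
    apply: (CAB c Cc).2; exists (h (c, c)); apply: GN.
    by right; split=> //=; [split; right|case=> + _; exact: (CAB c Cc).2].
  split; rewrite ?domE.
  - by move=> x [/GA//|/CAB[]].
  - move=> x y xBC yBC; have [[Bx By]|nBB] := pselect ((B `*` B) (x, y)).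
      by have [z Gz] := GT _ _ Bx By; exists z; left.
    by exists (h (x, y)); right.
  - by move=> x y z [/Gdom|[_ _ /= ->]]; [left|right].
  - move=> p q z [Gp|[pBC _ /= pz]] [Gq|[qBC _ /= qz]].
    + exact: GI Gp Gq.
    + by case: p Gp => x y /Gdom; rewrite qz => /(CAB _ (hC q)).2.
    + by case: q Gq => x y /Gdom; rewrite pz => /(CAB _ (hC p)).2.
    + by apply: hI; rewrite ?inE // -pz.
have [Bfin|Binf] := pselect (finite_set B).
  have ABinf : infinite_set (A `\` B) by exact: infinite_setD.
  have /card_subP[C CN CAB] : [set: nat] #<= A `\` B by apply/infiniteP.
  have NC : [set: nat] #<= C by rewrite (card_le_eqr CN).
  exfalso; apply: (noext C CAB).
    by apply: infinite_setN0; apply/infiniteP.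
  apply: card_le_trans NC.
  have BCc : countable (B `|` C).
    apply: (setU_card_le _ _ _ infinite_nat (countableP _)).
      exact: finite_set_countable.
    by rewrite (card_le_eql CN).
  exact: countableX.
have [ABB|BAB] := card_le_total (A `\` B) B.
  have AB : A #<= B.
    by rewrite -(setDUK GA); apply: setU_card_le.
  apply: card_le_trans (card_le_setX AB AB) _.
  exact: card_le_trans BB (subset_card_le GA).
have /card_subP[C CB CAB] := BAB; exfalso.
have [BC CB'] : B #<= C /\ C #<= B by split; rewrite (card_le_eqr CB, card_le_eql CB).
have BCB : B `|` C #<= B by exact: setU_card_le.
apply: (noext C CAB).
  apply: infinite_setN0; apply/infiniteP; apply: card_le_trans BC.
  exact/infiniteP.
by apply: card_le_trans (card_le_setX BCB BCB) _; exact: card_le_trans BB BC.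
Qed.

(** * Small density from the Baire property *)

Lemma discrete_subset_isolated {X : topologicalType} (D : set X) :
  discrete_subset D -> forall x, D x ->
  exists U, [/\ open U, U x & forall y, U y -> D y -> y = x].
Proof.
move=> Ddisc x Dx; pose x' : set_type D := exist _ x (mem_set Dx).
have [U Uo UE] := Ddisc [set x'].
exists U; split=> // [|y Uy Dy].
  by have : [set x'] x' by []; rewrite -UE.
have : [set x'] (exist _ y (mem_set Dy) : set_type D) by rewrite -UE.
by move=> /(congr1 val).
Qed.

Lemma baire_union_somewhere_dense {Y : topologicalType} (F : nat -> set Y) :
  baire_space Y -> [set: Y] !=set0 -> \bigcup_n F n = setT ->
  exists n, (interior (closure (F n))) !=set0.
Proof.
move=> Ybaire [y0 _] FT; apply: contrapT => /forallNP nd.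
have FC : dense (\bigcap_n ~` closure (F n)).
  apply: Ybaire => n; split; first exact/closed_openC/closed_closure.
  move=> O [y Oy] Oo; apply: contrapT => OF; apply: (nd n).
  exists y; apply: filterS (open_nbhs_nbhs (conj Oo Oy)) => z Oz.
  by apply: contrapT => nz; apply: OF; exists z.
have [|y [_ Fy]] := FC setT _ openT; first by exists y0.
have : [set: Y] y by [].
by rewrite -FT => -[n _ Fny]; exact/(Fy n)/subset_closure.
Qed.

(** A discrete set in a metric space is a countable union of uniformly
    separated sets. Each separated set has at most one point in a small ball, so
    K many of them with the same separation constant have at most K points there,
    and by the Baire property they are dense in such a ball for a suitable
    constant. *)
Lemma baire_metrizable_small_density {R : realType} {Y : topologicalType}
    {I : Type} (K : set I) (D : I -> set Y) :
  metrizable R Y -> baire_space Y -> [set: Y] !=set0 ->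
  (forall i x, K i -> D i x ->
     exists U : set Y, [/\ open U, U x & forall y, U y -> D i y -> y = x]) ->
  \bigcup_(i in K) D i = setT ->
  exists U S : set Y, [/\ open U, U !=set0, U `<=` closure S & S #<= K].
Proof.
move=> /metrizableP[d [d0 dp ds dt dn]] Ybaire Y0 Ddisc DT.
pose isolated n i x := D i x /\
  forall y, D i y -> (d x y < n.+1%:R^-1)%R -> y = x.
pose F n := [set x | exists2 i, K i & isolated n i x].
have FT : \bigcup_n F n = setT.
  apply/seteqP; split=> // x _.
  have : [set: Y] x by [].
  rewrite -DT => -[i Ki Dix].
  have [U [Uo Ux Ui]] := Ddisc i x Ki Dix.
  have /dn[e e0 eU] := open_nbhs_nbhs (conj Uo Ux).
  have [n ne] : exists n, (n.+1%:R^-1 < e :> R)%R.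
    by have [n] := ltr_add_invr e0; rewrite add0r; exists n.
  exists n => //; exists i => //; split=> // y Dy dxy; apply: Ui => //.
  by apply: eU => /=; exact: lt_trans dxy ne.
have [n [x xF]] := baire_union_somewhere_dense F Ybaire Y0 FT.
(* Half the separation constant: two points of the ball of radius r are then
   closer to each other than the constant. *)
pose r : R := (n.+1%:R^-1 / 2)%R.
have r0 : (0 < r)%R by rewrite divr_gt0 // invr_gt0.
pose B := interior (interior (closure (F n)) `&` [set y | d x y < r]%R).
exists B, (F n `&` B); split.
- exact: open_interior.
- exists x; apply: filterI; first by apply: open_nbhs_nbhs; split=> //; exact: open_interior.
  by apply/dn; exists r.
- move=> y By V Vy.
  have [/interior_subset Fy _] := interior_subset By.
  have : nbhs y (V `&` B) by apply: filterI => //; apply: open_nbhs_nbhs; split=> //; exact: open_interior.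
  by move=> /Fy[z [Fz [Vz Bz]]]; exists z.
apply: (card_le_rel (fun y i => K i /\ isolated n i y)).
  by move=> y [[i Ki iy] _]; exists i.
move=> y z i [_ /interior_subset[_ /= yr]] [_ /interior_subset[_ /= zr]].
move=> [_ [_ yi]] [_ [zi _]]; apply/esym/yi => //.
apply: le_lt_trans (dt x y z) _.
by rewrite (splitr n.+1%:R^-1) (ds y x) ltrD.
Qed.

(** A set dense in an open subset of a dense subspace is dense in any open set
    of the whole space with that trace. *)
Lemma dense_subspace_small_density {X : topologicalType} {J : Type}
    (K : set J) (M : set X) (U S : set (set_type M)) :
  dense M -> open U -> U !=set0 -> U `<=` closure S -> S #<= K ->
  exists V T : set X, [/\ open V, V !=set0, V `<=` closure T & T #<= K].
Proof.
move=> Md [V Vo VU] [u Uu] US SK; exists V, (val @` S); split=> //.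
- by exists (val u); move: Uu; rewrite -VU.
- move=> x Vx N /nbhs_interior Nx.
  have [||y [[Ny Vy] My]] := Md (interior N `&` V).
  + by exists x; split=> //; exact: nbhs_singleton Nx.
  + by apply: openI => //; exact: open_interior.
  pose y' : set_type M := exist _ y (mem_set My).
  have /US Sy : U y' by rewrite -VU.
  have [|z [Sz Nz]] := Sy (val @^-1` interior N).
    apply: open_nbhs_nbhs; split=> //.
    by exists (interior N) => //; exact: open_interior.
  by exists (val z); split; [exists z|exact: interior_subset].
- exact: card_le_trans (card_image_le _ _) SK.
Qed.

(** * Discrete sets in hereditarily meta-Lindelof spaces *)

(** Open sets O x isolating the points x of A inside V cover an open subspace W.
    A member of a point-countable refinement lies in a single O x, so it contains
    at most one point of A. Assigning to each point of A a point of S in a member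
    around it splits A into at most K pieces, all countable. *)
Lemma meta_lindelof_discrete_card {X : topologicalType} {I : Type}
    (K : set I) (A S V : set X) :
  hereditarily_meta_lindelof X -> infinite_set K -> discrete_subset A ->
  open V -> V `<=` closure S -> S #<= K -> A `&` V #<= K.
Proof.
move=> Xhml Kinf Adisc Vo VS SK.
have /choice[O OP] : forall x, exists O : set X, A x -> V x ->
    [/\ open O, O x, O `<=` V & forall y, O y -> A y -> y = x].
  move=> x; have [Ax|nAx] := pselect (A x); last by exists set0.
  have [U [Uo Ux Ui]] := discrete_subset_isolated _ Adisc x Ax.
  exists (U `&` V) => _ Vx; split=> //; first exact: openI.
  by move=> y [Uy _]; exact: Ui.
pose W := \bigcup_(x in A `&` V) O x.
have Wo : open W by apply: bigcup_open => x [Ax Vx]; have [] := OP x Ax Vx.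
have [|D [[Do DT] DO Dc]] := Xhml W [set (val @^-1` O x : set (set_type W)) | x in A `&` V].
  split=> [_ [x [Ax Vx] <-]|]; first by have [Oo _ _ _] := OP x Ax Vx; exists (O x).
  apply/seteqP; split=> // w _; have [x AVx Oxw] := set_mem (valP w).
  by exists (val @^-1` O x) => //; exists x.
(* The refinement consists of subsets of W; since W is open, they are open in
   X too, and so meet S. *)
pose lift (G : set (set_type W)) := (val @` G : set X).
have DI G x y : D G -> A x -> A y -> lift G x -> lift G y -> x = y.
  move=> /DO[_ [z [Az Vz] <-] GO] Ax Ay [u /GO/= Ou ux] [v /GO/= Ov vy].
  have [_ _ _ Oz] := OP z Az Vz.
  rewrite ux in Ou; rewrite vy in Ov.
  by rewrite (Oz x Ou Ax) (Oz y Ov Ay).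
have Dx x : A x -> V x -> exists2 G, D G & lift G x.
  move=> Ax Vx; have Wx : W x by exists x => //; have [] := OP x Ax Vx.
  have : [set: set_type W] (exist _ x (mem_set Wx)) by [].
  by rewrite -DT => -[G DG Gx]; exists G => //; exists (exist _ x (mem_set Wx)).
apply: card_le_trans (subset_card_le (B := \bigcup_(s in S)
   [set x | [/\ A x, V x & exists G, [/\ D G, lift G x & lift G s]]]) _) _.
  move=> x [Ax Vx]; have [G DG Gx] := Dx x Ax Vx.
  have Go : open (lift G).
    have [G' G'o G'E] := Do G DG.
    have -> : lift G = G' `&` W.
      apply/seteqP; split=> [_ [w Gw <-]|y [G'y Wy]].
        by split; [move: Gw; rewrite -G'E|exact: set_mem (valP w)].
      exists (exist _ y (mem_set Wy)) => //.
      by rewrite -G'E.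
    exact: openI.
  have [s [Ss Gs]] := VS _ Vx _ (open_nbhs_nbhs (conj Go Gx)).
  by exists s => //; split=> //; exists G.
apply: bigcup_card_le => //; first exact: infinite_setX_le.
move=> s Ss; apply: card_le_trans (_ : [set: nat] #<= K); last exact/infiniteP.
have [[w Ew]|ns] := pselect (exists w : set_type W, val w = s); last first.
  apply: (card_le_rel (fun _ _ => False)) => // x [_ _ [G [_ _ [w _ ws]]]].
  by exfalso; apply: ns; exists w.
apply: card_le_trans (Dc w).
apply: (card_le_rel (fun x G => D G /\ lift G x)).
  move=> x [Ax Vx [G [DG Gx [u Gu us]]]]; exists G; split=> //; split=> //.
  by have -> : w = u by apply/val_inj; rewrite Ew.
by move=> x y G [Ax _ _] [Ay _ _] [DG Gx] [_]; exact: DI.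
Qed.

(** * The inequality *)

Lemma finite_open_Delta_le1 {X : topologicalType} {J : Type} (V : set X)
    (K : set J) :
  hausdorff_space X -> open V -> finite_set V -> V !=set0 -> K !=set0 ->
  Delta X #<= K.
Proof.
move=> /hausdorff_accessible/accessible_finite_set_closed Xfc Vo Vfin [x Vx] [k Kk].
have xo : open [set x].
  have -> : [set x] = V `&` ~` (V `\ x).
    apply/seteqP; split=> [_ ->|y [Vy /not_andP[|/contrapT]]] //.
    by split=> // -[_]; apply.
  by apply: openI => //; apply: closed_openC; apply: Xfc; exact: finite_setD.
have [_ _ Dmin] := @DeltaP X (ex_intro _ x Logic.I).
apply: card_le_trans (Dmin _ xo (ex_intro _ x erefl)) _.
by rewrite (card_le_eql (eq_card1 x k)); apply: subset_card_le => _ ->.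
Qed.

Theorem theorem2p15 (R : realType) (X : topologicalType)
  (X_nonempty : [set: X] !=set0)
  (X_hausdorff : hausdorff_space X)
  (X_hml : hereditarily_meta_lindelof X)
  (X_dbm : exists M : set X,
     [/\ dense M, metrizable R (set_type M) & baire_space (set_type M)]) :
  dis X #>= Delta X.
Proof.
have [M [Md Mmet Mbaire]] := X_dbm.
have [disd disT _] := disP X.
have [_ _ Dmin] := DeltaP X_nonempty.
have M0 : [set: set_type M] !=set0.
  have [x [_ Mx]] := Md setT X_nonempty openT.
  by exists (exist _ x (mem_set Mx)).
have [||U [S [Uo U0 US SK]]] := baire_metrizable_small_density (dis X)
    (fun A => val @^-1` A : set (set_type M)) Mmet Mbaire M0.
- move=> A x /disd Ad Ax; have [O [Oo Ox Oi]] := discrete_subset_isolated _ Ad _ Ax.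
  exists (val @^-1` O); split=> //; first by exists O.
  by move=> y Oy Ay; apply/val_inj/Oi.
- apply/seteqP; split=> // x _; have : [set: X] (val x) by [].
  by rewrite -disT => -[A dA Ax]; exists A.
have [V [T [Vo V0 VT TK]]] := dense_subspace_small_density _ _ _ _ Md Uo U0 US SK.
have [disfin|disinf] := pselect (finite_set (dis X)).
  apply: (finite_open_Delta_le1 V) => //; last first.
    have [x _] := X_nonempty; have : [set: X] x by [].
    by rewrite -disT => -[A dA _]; exists A.
  have Tfin : finite_set T := card_le_finite TK disfin.
  apply: (sub_finite_set _ Tfin) => x /VT.
  rewrite -(iffLR (closure_id T)) //.
  by move: T Tfin {VT TK}; apply/accessible_finite_set_closed/hausdorff_accessible.
apply: card_le_trans (Dmin V Vo V0) _.
have -> : V = \bigcup_(A in dis X) (A `&` V).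
  by rewrite -setI_bigcupl disT setTI.
apply: bigcup_card_le => //; first exact: infinite_setX_le.
by move=> A /disd Ad; exact: meta_lindelof_discrete_card X_hml disinf Ad Vo VT TK.
Qed.
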